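(* Let $m\ge 2$ and $n\ge 4$, let $W_{m,n}=\overline{K}_m+C_n$ be the generalized wheel graph, and let $d:=n-m$. Then \[ \operatorname{nim}(\mathrm{TER}(W_{m,n}))=\begin{cases} 0, & n+m \text{ even and } 2\le d\\ 0, & n+m \text{ odd and } d \leq 0\\ 1, & n+m \text{ even and } d \leq 0\\ 1, & n+m \text{ odd and } 2\le d\\ 2, & d=1. \end{cases} \]
   Context: The generalized wheel graph $W_{m,n}$ is the join $\overline{K}_m+C_n$ of the edgeless graph on $m$ vertices and the cycle graph on $n$ vertices, i.e. their disjoint union together with all edges between the two vertex sets. For a graph $G$ with vertex set $V$, a set $K\subseteq V$ is convex if it contains every vertex lying on any shortest path between two elements of $K$. The convex hull $[P]$ of $P\subseteq V$ is the smallest convex set containing $P$. The game $\mathrm{TER}(G)$: positions are the sets $P\subseteq V$ reachable from the starting position $\emptyset$ by the following moves. If $[V\setminus P]=V$, then the options of $P$ are all sets $P\cup\{v\}$ with $v\in V\setminus P$; if $[V\setminus P]\neq V$, then $P$ is terminal (has no options). The nim-value of a position is defined recursively by $\operatorname{nim}(p)=\operatorname{mex}\{\operatorname{nim}(q): q\text{ an option of }p\}$, where $\operatorname{mex}(A)$ is the smallest nonnegative integer not in $A$; the nim-value of a game is that of its starting position. *)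

(* Defs.v *)
From mathcomp Require Import all_boot.
From mathcomp Require Import boolp.

Set Implicit Arguments.
Unset Strict Implicit.
Unset Printing Implicit Defensive.

Lemma mex_exists (A : seq nat) : exists n, n \notin A.
Proof.
exists (\max_(i <- A) i).+1; apply/negP => h.
have := @leq_bigmax_seq _ A xpredT id _ h isT.
by rewrite ltnn.
Qed.

Definition mex (A : seq nat) : nat := ex_minn (mex_exists A).

(* A graph is given by its adjacency relation on a finite type of vertices. *)
Section Convexity.
Variables (T : finType) (e : rel T).

(* A path from u to v is written u :: p, with size p edges; a walk of minimal
   length is automatically a path without repeated vertices. *)
Definition is_path (u v : T) (p : seq T) : bool := path e u p && (last u p == v).

Definition shortest_path (u v : T) (p : seq T) : Prop :=
  is_path u v p /\ (forall q : seq T, is_path u v q -> size p <= size q).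

Definition convex (K : {set T}) : Prop :=
  forall (u v : T) (p : seq T), u \in K -> v \in K -> shortest_path u v p ->
  {subset u :: p <= K}.

Definition hull (P : {set T}) : {set T} :=
  \bigcap_(K : {set T} | `[< convex K >] && (P \subset K)) K.

Lemma hull_sub (P : {set T}) : P \subset hull P.
Proof. by apply/bigcapsP => K /andP[]. Qed.

Lemma hull_convex (P : {set T}) : convex (hull P).
Proof.
move=> u v p /bigcapP hu /bigcapP hv sp x xp; apply/bigcapP => K hK.
have /andP[/asboolP cK _] := hK.
exact: cK (hu _ hK) (hv _ hK) sp x xp.
Qed.

Lemma hull_min (P K : {set T}) : convex K -> P \subset K -> hull P \subset K.
Proof. by move=> cK PK; apply: bigcap_inf; rewrite PK andbT; apply/asboolP. Qed.

End Convexity.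

Section TER.
Variables (T : finType) (e : rel T).

Definition TER_options (P : {set T}) : {set {set T}} :=
  if hull e (~: P) == setT then [set v |: P | v in ~: P] else set0.

(* The recursion is bounded by k, an upper bound on the number of vertices
   outside P; TER_nimE below is the unbounded recursive equation. *)
Fixpoint TER_nim_rec (k : nat) (P : {set T}) : nat :=
  if k is k'.+1 then mex [seq TER_nim_rec k' Q | Q <- enum (TER_options P)]
  else mex [::].

Definition TER_nim (P : {set T}) : nat := TER_nim_rec #|~: P| P.

Lemma TER_options_card (P Q : {set T}) :
  Q \in TER_options P -> #|~: P| = #|~: Q|.+1.
Proof.
rewrite /TER_options; case: ifP => _; last by rewrite inE.
by case/imsetP => v vP ->; rewrite setCU setIC -setDE (cardsD1 v (~: P)) vP.
Qed.

Lemma TER_nimE (P : {set T}) :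
  TER_nim P = mex [seq TER_nim Q | Q <- enum (TER_options P)].
Proof.
rewrite /TER_nim; case E: #|~: P| => [|k] /=.
  case O: (enum _) => [//|Q s].
  have : Q \in TER_options P by rewrite -mem_enum O mem_head.
  by move/TER_options_card; rewrite E.
congr mex; apply/eq_in_map => Q; rewrite mem_enum => /TER_options_card.
by rewrite E => -[->].
Qed.

Definition nim_TER : nat := TER_nim set0.

End TER.

Definition edgeless (m : nat) : rel 'I_m := fun _ _ => false.

(* ordS i is i + 1 modulo n. *)
Definition cycle_graph (n : nat) : rel 'I_n :=
  fun i j => (j == ordS i) || (i == ordS j).

Definition graph_join (T1 T2 : finType) (e1 : rel T1) (e2 : rel T2) :
    rel (T1 + T2) :=
  fun x y => match x, y with
    | inl a, inl b => e1 a b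
    | inr a, inr b => e2 a b
    | _, _ => true
    end.

Definition wheel (m n : nat) : rel ('I_m + 'I_n) :=
  graph_join (@edgeless m) (@cycle_graph n).

(* Main.v *)
(* In the wheel, a set of vertices generates everything iff it is not a clique,
   so the game ends when the remaining vertices form a clique.  The nim-value of
   a position whose remaining rim vertices R do not form the whole cycle depends
   only on the number a of remaining hubs, on r = #|R| and on the size c of a
   minimum vertex cover of R.  R induces a linear forest, hence c is also the size
   of a maximum matching, and the options of (a, r, c) are (a - 1, r, c) if a > 0,
   (a, r - 1, c - 1) if c > 0 (remove a cover vertex) and (a, r - 1, c) if 2c < r
   (remove an unmatched vertex).  This recursion has an explicit solution, as has
   the one for the full cycle, whose rim options all have r = n - 1 and
   c = floor((n - 1) / 2). *)
Require Import Defs.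
From mathcomp Require Import all_boot all_order all_algebra.
From mathcomp Require Import zify.

Set Implicit Arguments.
Unset Strict Implicit.
Unset Printing Implicit Defensive.

(** * Arithmetic solution of the two recursions *)

(** Describes the positions whose remaining vertices form a clique: for two rim vertices, [c = 1]
    means that they are adjacent. *)
Definition path_terminal (a r c : nat) : bool :=
  (a <= 1) && ((r <= 1) || (r == 2) && (c == 1)).

(* a hubs remain, together with r rim vertices whose minimum vertex covers have
   size c *)
Definition path_nim (a r c : nat) : nat :=
  if path_terminal a r c then 0
  else if [|| a + c.*2 == r.+1, a.+1 == r | (a == 0) && (r == c.*2.+1)] then 2
  else if [|| (r.+1 < a + c.*2) && (a.+1 < r), (a == r) && (c == 0)
            | (a == 0) && (r == c.*2)] then nat_of_bool (odd (a + r))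
  else nat_of_bool (~~ odd (a + r)).

(** Flattens the nested conditionals into cases with linear hypotheses. The parity of [a + r] is
    abstracted as [b], which is forced to be true whenever the value is 2. *)
Variant path_nim_spec (a r c : nat) (b : bool) : nat -> Prop :=
  | PathTerm1 of a <= 1 & r <= 1 : path_nim_spec a r c b 0
  | PathTerm2 of a <= 1 & r = 2 & c = 1 : path_nim_spec a r c b 0
  | PathTwo1 of b & a + c.*2 = r.+1 & c.+2 < a + r : path_nim_spec a r c b 2
  | PathTwo2 of b & a.+1 = r & c.+2 < a + r : path_nim_spec a r c b 2
  | PathTwo3 of b & a = 0 & r = c.*2.+1 & 2 < r : path_nim_spec a r c b 2
  | PathIn1 of r.+1 < a + c.*2 & a.+1 < r : path_nim_spec a r c b b
  | PathIn2 of a = r & c = 0 & 2 <= r : path_nim_spec a r c b b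
  | PathIn3 of a = 0 & r = c.*2 & 2 < r : path_nim_spec a r c b b
  | PathOut1 of a + c.*2 < r.+1 & a.+1 < r & c.*2.+1 < a + r :
      path_nim_spec a r c b (~~ b)
  | PathOut2 of r <= a & 0 < c & 2 <= a : path_nim_spec a r c b (~~ b)
  | PathOut3 of r.+2 <= a & c = 0 : path_nim_spec a r c b (~~ b).

Lemma path_nimP a r c :
  c.*2 <= r -> path_nim_spec a r c (odd (a + r)) (path_nim a r c).
Proof.
move=> cr; rewrite /path_nim.
have [tm|ntm] := boolP (path_terminal a r c).
  move: tm; rewrite /path_terminal => /andP[a1 /orP[r1|/andP[/eqP r2 /eqP c1]]].
    by constructor 1.
  by constructor 2.
rewrite /path_terminal in ntm.
case: ifP => [/or3P[/eqP h|/eqP h|/andP[/eqP h1 /eqP h2]]|/negbT h].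
- by constructor 3; lia.
- by constructor 4; lia.
- by constructor 5; lia.
case: ifP => [|/negbT h'].
  case/or3P => /andP[h1 h2]; first by constructor 6.
    by constructor 7; lia.
  by constructor 8; lia.
have [har|har] := ltnP a.+1 r; first by constructor 9; lia.
have [hc|hc] := posnP c; first by constructor 11; lia.
by constructor 10; lia.
Qed.

(** Each move flips the parity of [a + r], so a position and its options can be analysed with one
    shared Boolean. *)
Lemma path_nim_hubP a r c : c.*2 <= r -> 0 < a ->
  path_nim_spec a.-1 r c (~~ odd (a + r)) (path_nim a.-1 r c).
Proof. by case: a => // a cr _; rewrite addSn oddS negbK; apply: path_nimP. Qed.

Lemma path_nim_coverP a r c : c.*2 <= r -> 0 < c ->
  path_nim_spec a r.-1 c.-1 (~~ odd (a + r)) (path_nim a r.-1 c.-1).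
Proof.
case: r c => [|r] [|c] // cr _; rewrite addnS oddS negbK; apply: path_nimP.
by lia.
Qed.

Lemma path_nim_spareP a r c : c.*2 < r ->
  path_nim_spec a r.-1 c (~~ odd (a + r)) (path_nim a r.-1 c).
Proof. by case: r => // r cr; rewrite addnS oddS negbK; apply: path_nimP. Qed.

(** Together with [path_nim_reach], this shows that [path_nim] solves the mex recursion. *)
Lemma path_nim_avoid a r c : c.*2 <= r -> ~~ path_terminal a r c ->
  [/\ 0 < a -> path_nim a.-1 r c <> path_nim a r c,
      0 < c -> path_nim a r.-1 c.-1 <> path_nim a r c
    & c.*2 < r -> path_nim a r.-1 c <> path_nim a r c].
Proof.
(* [par] ties the parity to the half of [a + r]; once both are variables, each pair of cases is
   linear arithmetic. *)
rewrite /path_terminal => cr nt; have par := odd_double_half (a + r).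
have P := path_nimP a cr.
split=> h; [have Q := path_nim_hubP cr h | have Q := path_nim_coverP a cr h
           | have Q := path_nim_spareP a h];
  move: (odd _) (half _) par P Q => b h2 par P Q; destruct P, Q; lia.
Qed.

Ltac move_with P :=
  let h := fresh in let q := fresh in
  match type of P with ?C -> _ =>
    assert (h : C) by (clear P; lia); assert (q := P h); clear P end;
  split; [by [] | clear h; destruct q; lia].
Ltac hub Ph Pc Ps := clear Pc Ps; constructor 1; move_with Ph.
Ltac cover Ph Pc Ps := clear Ph Ps; constructor 2; move_with Pc.
Ltac spare Ph Pc Ps := clear Ph Pc; constructor 3; move_with Ps.

Lemma path_nim_reach a r c u : c.*2 <= r -> u < path_nim a r c ->
  [\/ 0 < a /\ path_nim a.-1 r c = u,
      0 < c /\ path_nim a r.-1 c.-1 = u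
    | c.*2 < r /\ path_nim a r.-1 c = u].
Proof.
move=> cr; have P := path_nimP a cr.
have Ph := @path_nim_hubP a _ _ cr.
have Pc := path_nim_coverP a cr.
have Ps := @path_nim_spareP a r c.
move: (odd_double_half (a + r)).
move: (path_nim a.-1 r c) (path_nim a r.-1 c.-1) (path_nim a r.-1 c) Ph Pc Ps.
move=> vh vc vs.
move: (odd _) (half _) P => b h2 P Ph Pc Ps par.
(* The three cases of value 2 are treated together: [a + r] is odd, and both 0 and 1 must be
   attained. *)
have two : b ->
    (a + c.*2 = r.+1 \/ a.+1 = r) /\ c.+2 < a + r
      \/ a = 0 /\ r = c.*2.+1 /\ 2 < r ->
    u < 2 -> [\/ 0 < a /\ vh = u, 0 < c /\ vc = u | c.*2 < r /\ vs = u].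
  clear P; case: u => [|[|//]] hb D _.
    case: (posnP c) => hc.
      case: (eqVneq a 1) => ha; first by spare Ph Pc Ps.
      case: (ltnP a r) => har; first by spare Ph Pc Ps.
      by hub Ph Pc Ps.
    case: (ltnP a r.-1) => har.
      case: (eqVneq r c.*2) => hk; first by hub Ph Pc Ps.
      by spare Ph Pc Ps.
    case: (eqVneq c 1) => hc1; first by cover Ph Pc Ps.
    by hub Ph Pc Ps.
  case: (posnP a) => ha; first by cover Ph Pc Ps.
  case: (posnP c) => hc.
    case: (ltnP a r) => har; first by hub Ph Pc Ps.
    by spare Ph Pc Ps.
  case: (eqVneq c 1) => hc1; first by spare Ph Pc Ps.
  by cover Ph Pc Ps.
destruct P => //; try by move=> u2; apply: two => //; tauto.
(* The remaining values are at most 1, so only [u = 0] against value 1 is left. *)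
all: clear two; case: b par Ph Pc Ps => // par Ph Pc Ps; case: u => // _.
- by hub Ph Pc Ps.
(* Here and in the next case [a + r] is even, against the assumed odd parity. *)
- by clear Ph Pc Ps; lia.
- by clear Ph Pc Ps; lia.
- case: (posnP a) => ha.
    by case: (posnP c) => hc; [spare Ph Pc Ps | cover Ph Pc Ps].
  case: (eqVneq c 1) => hc1.
    by case: (eqVneq a 1) => ha1; [spare Ph Pc Ps | hub Ph Pc Ps].
  by case: (posnP c) => hc; [hub Ph Pc Ps | cover Ph Pc Ps].
- case: (eqVneq c 1) => hc1.
    by case: (eqVneq r c.*2) => hk; [hub Ph Pc Ps | spare Ph Pc Ps].
  case: (leqP a r) => har; first by cover Ph Pc Ps.
  by case: (eqVneq r c.*2) => hk; [hub Ph Pc Ps | spare Ph Pc Ps].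
- by case: (eqVneq r c.*2) => hk; [hub Ph Pc Ps | spare Ph Pc Ps].
Qed.

(** Value with [a] hubs and the whole rim left. A hub move lowers [a]; a rim move leads to
    [path_nim a n.-1 n.-1./2]. *)
Definition cycle_nim (a n : nat) : nat :=
  if (a.+1 == n) || ~~ odd n && (a == 1) then 2
  else if a.+1 < n then nat_of_bool (odd (a + n))
  else nat_of_bool (~~ odd (a + n)).

Ltac split_ifs := repeat match goal with
  |- context [if ?b then _ else _] => let E := fresh in destruct b eqn:E end.

Lemma cycle_nim_avoid a n : 3 < n ->
  (0 < a -> cycle_nim a.-1 n <> cycle_nim a n) /\
  path_nim a n.-1 n.-1./2 <> cycle_nim a n.
Proof.
move=> n3; rewrite /cycle_nim; split.
  case: a => // a _; rewrite succnK addSn oddS.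
  by split_ifs; lia.
have P := @path_nimP a n.-1 n.-1./2 ltac:(lia).
have E1 : odd (a + n) = ~~ odd (a + n.-1) by lia.
have E2 := odd_double_half n.-1; have E3 := odd_double_half (a + n.-1).
by rewrite E1; destruct P; split_ifs; lia.
Qed.

Lemma cycle_nim_reach a n u : 3 < n -> u < cycle_nim a n ->
  0 < a /\ cycle_nim a.-1 n = u \/ path_nim a n.-1 n.-1./2 = u.
Proof.
move=> n3 lu.
have P := @path_nimP a n.-1 n.-1./2 ltac:(lia).
have E2 := odd_double_half n.-1; have E3 := odd_double_half (a + n.-1).
have [a0|a0] := posnP a.
  right; move: lu; rewrite /cycle_nim.
  have -> : odd (a + n) = ~~ odd (a + n.-1) by lia.
  by destruct P; split_ifs; lia.
(* If the rim option misses [u], the hub option attains it. *)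
have [<-|ne] := eqVneq (path_nim a n.-1 n.-1./2) u; [by right | left; split=> //].
move: lu; rewrite /cycle_nim.
have -> : odd (a + n) = ~~ odd (a + n.-1) by lia.
have -> : odd (a.-1 + n) = odd (a + n.-1) by lia.
by destruct P; split_ifs; lia.
Qed.

(** * Minimum vertex covers certified by matchings *)

Section Konig.
Variables (T : finType) (e : rel T).
Implicit Types (R C : {set T}) (g : T -> T).

Definition vertex_cover R C :=
  {in R &, forall x y, e x y -> (x \in C) || (y \in C)}.

(* By Koenig duality, g matches the vertices of the cover C with vertices
   outside C, which certifies that C is a minimum cover. *)
Definition konig R C g :=
  [/\ C \subset R, vertex_cover R C,
      {in C, forall x, (g x \in R :\: C) && e x (g x)} & {in C &, injective g}].

(** The matching edges from [x] to [g x] are disjoint and [D] meets each of them; [h] picks an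
    endpoint in [D]. *)
Lemma konig_cover_min R C g D :
  konig R C g -> vertex_cover R D -> #|C| <= #|D|.
Proof.
case=> CR _ gC gI covD; pose h x := if x \in D then x else g x.
have hI : {in C &, injective h}.
  move=> x y xC yC; rewrite /h; case: ifP => _; case: ifP => _ //.
  - by move=> E; have := gC _ yC; rewrite -E !inE xC.
  - by move=> E; have := gC _ xC; rewrite E !inE yC.
  - exact: gI.
rewrite -(card_in_imset hI); apply/subset_leq_card/subsetP => _ /imsetP[x xC ->].
rewrite /h; case: ifP => // xD; have /andP[] := gC _ xC.
rewrite inE => /andP[_ gR] /(covD _ _ (subsetP CR _ xC) gR).
by rewrite xD.
Qed.

Lemma konig_half R C g : konig R C g -> #|C|.*2 <= #|R|.
Proof.
case=> CR _ gC gI; rewrite -(cardsID C R) -addnn (setIidPr CR) leq_add2l.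
rewrite -(card_in_imset gI); apply/subset_leq_card/subsetP => _ /imsetP[x xC ->].
by case/andP: (gC _ xC).
Qed.

(** By counting, some vertex is neither in the cover nor matched; deleting it realizes the move to
    [(a, r - 1, c)]. *)
Lemma konig_spare R C g : konig R C g -> #|C|.*2 < #|R| ->
  exists2 v, v \in R & konig (R :\ v) C g.
Proof.
case=> CR cov gC gI ltR.
have : (C :|: g @: C) \proper R.
  rewrite properEcard subUset CR /=; apply/andP; split.
    apply/subsetP => _ /imsetP[x xC ->].
    by have := gC _ xC; rewrite inE => /andP[/andP[]].
  apply: leq_ltn_trans ltR; apply: leq_trans (leq_card_setU _ _) _.
  by rewrite (card_in_imset gI) addnn.
case/properP => _ [v vR]; rewrite inE negb_or => /andP[vC vg].
exists v => //; split=> //.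
- by rewrite subsetD1 CR.
- by move=> x y /setD1P[_ xR] /setD1P[_ yR]; apply: cov.
- move=> x xC; have := gC _ xC; rewrite !inE => /andP[/andP[-> ->] ->].
  by rewrite !andbT; apply: contraNneq vg => <-; apply: imset_f.
Qed.

(** Deleting a cover vertex only frees its partner; this realizes the move to
    [(a, r - 1, c - 1)]. *)
Lemma konig_drop R C g v : konig R C g -> v \in C -> konig (R :\ v) (C :\ v) g.
Proof.
case=> CR cov gC gI vC; split.
- exact: setSD.
- move=> x y /setD1P[xv xR] /setD1P[yv yR] /(cov _ _ xR yR).
  by rewrite !inE xv yv.
- move=> x /setD1P[xv xC]; have := gC _ xC.
  rewrite !inE => /andP[/andP[gx ->] ->]; rewrite (negPf gx) andbF !andbT /=.
  by apply: contraNneq gx => ->.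
- by move=> x y /setD1P[_ xC] /setD1P[_ yC]; apply: gI.
Qed.

(** [C] still covers what is left, and [C'] with [v] added covers [R]. Hence every rim move is of
    one of the two kinds above. *)
Lemma konig_del R C g v C' g' : konig R C g -> konig (R :\ v) C' g' ->
  #|C'| <= #|C| <= #|C'|.+1.
Proof.
move=> k k'; apply/andP; split.
  apply: konig_cover_min k' _ => x y /setD1P[_ xR] /setD1P[_ yR].
  by case: k => _ cov _ _; apply: cov.
apply: leq_trans (konig_cover_min (D := v |: C') k _) _; last first.
  by rewrite cardsU1; case: (_ \notin _).
move=> x y xR yR exy; rewrite !inE.
have [//|xv] := eqVneq x v; have [|yv] := eqVneq y v; first by rewrite orbT.
by case: k' => _ cov _ _; apply: cov => //; rewrite !inE ?xv ?yv.
Qed.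

Definition clique (S : {set T}) := {in S &, forall x y, x != y -> e x y}.

(** No edge joins two vertices outside [C], so a clique has at most one such vertex; the bound
    [2c <= r] then leaves only these sizes. Conversely, [r = 2] and [c = 1] leave a single matching
    edge. *)
Lemma konig_clique R C g : symmetric e -> konig R C g ->
  (clique R <-> (#|R| <= 1) || (#|R| == 2) && (#|C| == 1)).
Proof.
move=> eC k; have half := konig_half k; have [CR cov gC gI] := k; split.
  move=> cl; have : #|R :\: C| <= 1.
    apply/card_le1_eqP => x y; rewrite !inE => /andP[xC xR] /andP[yC yR].
    apply/eqP; apply: contraNT xC => xy.
    by have := cov _ _ yR xR (cl _ _ yR xR xy); rewrite (negPf yC).
  have := cardsID C R; rewrite (setIidPr CR); lia.
case/orP => [/card_le1_eqP R1 x y xR yR|]; first by rewrite (R1 x y) ?eqxx.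
case/andP => /eqP R2 /cards1P[x Cx].
have xC : x \in C by rewrite Cx inE.
have /andP[gR exg] := gC _ xC.
have /eqP RE : [set x; g x] == R.
  rewrite eqEcard subUset !sub1set (subsetP CR) //=.
  move: gR; rewrite inE => /andP[gx ->].
  rewrite R2 cards2; case: eqP gx => // <-; by rewrite xC.
rewrite -RE => y z; rewrite !inE => /orP[]/eqP-> /orP[]/eqP->; rewrite ?eqxx //.
by rewrite eC.
Qed.

End Konig.

(** * Covers and matchings in the cycle *)

Section Cycle.
Variable n : nat.
Implicit Types R C : {set 'I_n}.

Lemma cycle_sym : symmetric (@cycle_graph n).
Proof. by move=> x y; rewrite /cycle_graph orbC. Qed.

(** A nonempty set closed under successor contains the orbit of one of its vertices, which is the
    whole cycle. *)
Lemma cycle_boundary R : R != set0 -> R != setT ->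
  exists2 x, x \in R & ordS x \notin R.
Proof.
case/set0Pn => x0 x0R RT; apply/exists_inP; apply: contraR RT => /exists_inPn clo.
have it k : iter k (@ordS n) x0 \in R.
  by elim: k => //= k /clo; rewrite negbK.
have itE k : iter k (@ordS n) x0 = (x0 + k) %% n :> nat.
  elim: k => [|k IH] /=; first by rewrite addn0 modn_small.
  by rewrite IH addnS -[in LHS]addn1 modnDml addn1.
(* This many steps lead from [x0] to [y + n], which is [y] modulo [n]. *)
apply/eqP/setP => y; rewrite inE; have := it (y + (n - x0)).
suff -> : iter (y + (n - x0)) (@ordS n) x0 = y by [].
apply: val_inj; rewrite /= itE addnCA subnKC; last exact: ltnW.
by rewrite modnDr modn_small.
Qed.

(* Peel off the end x of a maximal run of R, with its predecessor p if p is in R: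
   then p joins the cover and is matched with x. *)
Lemma cycle_konig R : R != setT -> exists C g, konig (@cycle_graph n) R C g.
Proof.
have [k] := ubnP #|R|; elim: k R => // k IH R; rewrite ltnS => Rk RT.
have [->|R0] := eqVneq R set0.
  by exists set0, id; split=> // x; rewrite ?inE // => y; rewrite inE.
have [x xR SxR] := cycle_boundary R0 RT.
have subT R' : R' \subset R -> R' != setT.
  by move=> sub; apply: contraNneq RT => E; rewrite -subTset -E.
have SxE y : y \in R -> cycle_graph x y -> y = ord_pred x.
  move=> yR /orP[/eqP E|/eqP ->]; last by rewrite ordSK.
  by rewrite -E yR in SxR.
(* If the predecessor is missing too, [x] is isolated in [R], and the cover and matching of the rest
   are kept. *)
have [|pR] := boolP (ord_pred x \in R); last first.
  have [||C [g k']] := IH (R :\ x).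
  - by move: Rk; rewrite (cardsD1 x R) xR.
  - exact/subT/subD1set.
  case: k' => CR cov gC gI; exists C, g; split=> //.
  - exact: subset_trans CR (subD1set _ _).
  - move=> y z yR zR yz.
    have [yx|yx] := eqVneq y x.
      by move: yz pR; rewrite yx => /(SxE _ zR) <-; rewrite zR.
    have [zx|zx] := eqVneq z x.
      by move: yz pR; rewrite zx cycle_sym => /(SxE _ yR) <-; rewrite yR.
    by apply: cov => //; rewrite !inE ?yx ?zx.
  - by move=> y yC; have := gC _ yC; rewrite !inE => /andP[/andP[-> /andP[_ ->]] ->].
set p := ord_pred x => pR.
have px : p != x by apply: contraNneq SxR => <-; rewrite ord_predK.
have [||C [g k']] := IH (R :\ x :\ p).
- move: Rk; rewrite (cardsD1 x R) xR; apply: leq_trans.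
  exact/subset_leq_card/subD1set.
- by apply: subT; rewrite (subset_trans (subD1set _ _)) ?subD1set.
have [CR cov gC gI] := k'.
have pC : p \notin C by apply: contraTN isT => /(subsetP CR); rewrite !inE eqxx.
have xC : x \notin C by apply: contraTN isT => /(subsetP CR); rewrite !inE eqxx andbF.
have CRR : {subset C <= R}.
  by move=> y /(subsetP CR); rewrite !inE => /andP[_ /andP[]].
have gD y : y \in C -> (g y != p) && (g y != x).
  by move=> /gC; rewrite !inE => /andP[/andP[_ /andP[-> /andP[->]]]].
exists (p |: C), (fun y => if y == p then x else g y); split.
- by rewrite subUset sub1set pR; apply/subsetP.
- move=> y z yR zR yz; rewrite !inE.
  have [//|yp] := eqVneq y p; have [|zp] := eqVneq z p; first by rewrite orbT.
  have [yx|yx] := eqVneq y x.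
    by move: yz zp; rewrite yx => /(SxE _ zR) ->; rewrite eqxx.
  have [zx|zx] := eqVneq z x.
    by move: yz yp; rewrite zx cycle_sym => /(SxE _ yR) ->; rewrite eqxx.
  by apply: cov => //; rewrite !inE ?yx ?zx ?yp ?zp.
- move=> y; rewrite !inE; have [->|yp] /= := eqVneq y p => [_|yC].
    by rewrite negb_or (eq_sym x) px xC xR /cycle_graph ord_predK eqxx.
  have := gC _ yC; have := gD _ yC.
  by rewrite !inE negb_or => /andP[-> _] /andP[/andP[-> /andP[_ /andP[_ ->]]] ->].
- move=> y z; rewrite !inE.
  have [->|yp] /= := eqVneq y p; have [->|zp] /= := eqVneq z p => //.
  + by move=> _ /gD /andP[_ /eqP + E]; rewrite E.
  + by move=> /gD /andP[_ /eqP + _ E]; rewrite E.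
  + exact: gI.
Qed.

(* A cover C of the path left by deleting v satisfies 2 #|C| >= n - 2, because
   each of its vertices covers at most two edges. *)
Lemma cycle_del_konig v C g : konig (@cycle_graph n) [set~ v] C g -> #|C| = n.-1./2.
Proof.
move=> k; have := konig_half k; rewrite cardsC1 card_ord => le1.
have [_ cov _ _] := k.
(* Every [x] other than [v] and its predecessor starts an edge to [ordS x] in the path, so [x] or
   [ordS x] lies in [C]. *)
have : #|[set: 'I_n]| <= #|C| + #|@ordS n @^-1: C| + 2.
  have h2 : #|[set v; ord_pred v]| <= 2 by rewrite cards2; case: eqP.
  apply: leq_trans (leq_add (leqnn _) h2).
  apply: leq_trans (leq_add (leq_card_setU _ _) (leqnn _)).
  apply: leq_trans (leq_card_setU _ _); apply/subset_leq_card/subsetP => x _.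
  rewrite !inE; have [|xv] := eqVneq x v; first by rewrite orbT.
  have [->|xp] := eqVneq x (ord_pred v); first by rewrite !orbT.
  rewrite !orbF; apply: cov; rewrite ?inE //; last by rewrite /cycle_graph eqxx.
  by apply: contraNneq xp => <-; rewrite ordSK.
rewrite cardsT card_ord card_preimset; last exact: ordS_inj.
by move: #|C| le1 => c; lia.
Qed.

End Cycle.

(** * Nim-values from the two halves of the mex condition *)

Lemma mex_eq (A : seq nat) v :
  v \notin A -> (forall u, u < v -> u \in A) -> mex A = v.
Proof.
move=> vA uA; rewrite /mex; case: ex_minnP => w wA /(_ _ vA) wv.
by apply/eqP; rewrite eqn_leq wv /= leqNgt; apply: contra wA; apply: uA.
Qed.

Section NimValue.
Variables (T : finType) (e : rel T).

Lemma TER_nim_terminal (P : {set T}) : hull e (~: P) != setT -> TER_nim e P = 0.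
Proof.
move=> hP; rewrite TER_nimE /TER_options (negPf hP) enum_set0.
exact: mex_eq.
Qed.

Lemma TER_nim_eq (P : {set T}) v : hull e (~: P) = setT ->
  (forall x, x \notin P -> TER_nim e (x |: P) <> v) ->
  (forall u, u < v -> exists2 x, x \notin P & TER_nim e (x |: P) = u) ->
  TER_nim e P = v.
Proof.
move=> hP avoid reach; rewrite TER_nimE /TER_options hP eqxx; apply: mex_eq.
  apply/mapP => -[Q]; rewrite mem_enum => /imsetP[x].
  by rewrite inE => xP -> /esym; apply: avoid.
move=> u /reach [x xP <-]; apply/mapP; exists (x |: P) => //.
by rewrite mem_enum; apply/imsetP; exists x; rewrite ?inE.
Qed.

End NimValue.

(** * Convexity of cliques and paths of length two *)

Section Hull.
Variables (T : finType) (e : rel T).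

(** The path through [z] has length 2 and is shortest, since [x] and [y] are distinct and not
    adjacent. *)
Lemma convex_common (K : {set T}) x y z : convex e K -> x \in K -> y \in K ->
  x != y -> ~~ e x y -> e x z -> e z y -> z \in K.
Proof.
move=> cK xK yK xy nexy exz ezy.
apply: (cK x y [:: z; y] xK yK _ z); last by rewrite !inE eqxx orbT.
split=> [|[|a [|b q]]] //; rewrite /is_path /= ?exz ?ezy ?eqxx //.
  by rewrite (negPf xy).
by rewrite andbT => /andP[exa /eqP E]; rewrite E (negPf nexy) in exa.
Qed.

Lemma clique_convex (K : {set T}) : clique e K -> convex e K.
Proof.
move=> cl u v p uK vK [/andP[_ /eqP lp] short] x.
have [uv|uv] := eqVneq u v.
  have := short [::]; rewrite /is_path /= uv eqxx => /(_ isT).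
  by case: p {lp short} => //= _; rewrite inE => /eqP ->.
have := short [:: v]; rewrite /is_path /= eqxx (cl u v) // => /(_ isT).
case: p lp {short} => [|y [|//]] /=; first by move=> E; rewrite E eqxx in uv.
by move=> -> _; rewrite !inE => /orP[]/eqP->.
Qed.

End Hull.

(** * The game on the wheel *)

Section Wheel.
Variables m n : nat.
Hypotheses (m_gt1 : 1 < m) (n_gt3 : 3 < n).
Local Notation V := ('I_m + 'I_n)%type.
Local Notation W := (@wheel m n).
Local Notation cyc := (@cycle_graph n).
Implicit Types P S : {set V}.

Lemma cycle_nonadjacent : exists i j : 'I_n, (i != j) && ~~ cyc i j.
Proof.
have h0 : 0 < n by lia.
have h2 : 2 < n by lia.
exists (Ordinal h0), (Ordinal h2).
rewrite /cycle_graph -!val_eqE /= !modn_small //; lia.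
Qed.

(** Two hubs have all rim vertices as common neighbours, and two nonadjacent rim vertices have all
    hubs. Either kind of pair thus generates one side, which contains a pair generating the other
    side. *)
Lemma wheel_hull S : clique W S \/ hull W S = setT.
Proof.
have [cl|] := boolP [forall x in S, forall y in S, (x != y) ==> W x y].
  left=> x y xS yS; have /forall_inP/(_ _ xS)/forall_inP/(_ _ yS)/implyP := cl; exact.
case/forall_inPn => x xS /forall_inPn[y yS]; rewrite negb_imply => /andP[xy nexy].
right; apply/setP => z; rewrite inE.
have cH := @hull_convex _ W S; have sub := subsetP (@hull_sub _ W S).
move/sub: xS yS => xH /sub yH; move: (hull W S) cH xH yH => H cH xH yH {sub}.
pose h0 := Ordinal (ltnW m_gt1); pose h1 := Ordinal m_gt1.
have [i [j /andP[ij nij]]] := cycle_nonadjacent.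
have hubs_rims (a b : 'I_m) k : a != b -> inl a \in H -> inl b \in H -> inr k \in H.
  by move=> ab aH bH; apply: (convex_common cH aH bH).
have rims_hubs (a b : 'I_n) k :
    a != b -> ~~ cyc a b -> inr a \in H -> inr b \in H -> inl k \in H.
  by move=> ab nab aH bH; apply: (convex_common cH aH bH).
have [HL HR] : (forall k, inl k \in H) /\ (forall k, inr k \in H); last by case: z.
case: x y xy nexy xH yH => [a|a] [b|b] // ab nab aH bH.
  have HR k : inr k \in H by apply: hubs_rims aH bH.
  by split=> // k; apply: (rims_hubs i j).
have HL k : inl k \in H by apply: rims_hubs aH bH.
by split=> // k; apply: (hubs_rims h0 h1).
Qed.

(** A clique is convex, hence its own hull, but two hubs are never adjacent. *)
Lemma wheel_clique_hull S : clique W S -> hull W S != setT.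
Proof.
move=> cl; apply/eqP => E.
have := hull_min (clique_convex cl) (subxx S); rewrite E => /subsetP sub.
have inS x : x \in S by apply: sub; rewrite inE.
by have := cl _ _ (inS (inl (Ordinal (ltnW m_gt1)))) (inS (inl (Ordinal m_gt1))) isT.
Qed.

Definition hubs P : {set 'I_m} := [set i | inl i \notin P].
Definition rim P : {set 'I_n} := [set j | inr j \notin P].

Lemma hubs_inl i P : hubs (inl i |: P) = hubs P :\ i.
Proof. by apply/setP => j; rewrite !inE negb_or. Qed.

Lemma hubs_inr j P : hubs (inr j |: P) = hubs P.
Proof. by apply/setP => i; rewrite !inE. Qed.

Lemma rim_inl i P : rim (inl i |: P) = rim P.
Proof. by apply/setP => j; rewrite !inE. Qed.

Lemma rim_inr j P : rim (inr j |: P) = rim P :\ j.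
Proof. by apply/setP => i; rewrite !inE negb_or. Qed.

Lemma wheel_clique P : clique W (~: P) <-> #|hubs P| <= 1 /\ clique cyc (rim P).
Proof.
split=> [cl|[h1 cl]].
  split; last first.
    by move=> x y xR yR xy; apply: (cl (inr x) (inr y)); rewrite !inE in xR yR *.
  apply/card_le1_eqP => x y xR yR; apply/eqP; case: eqVneq => // xy.
  rewrite !inE in xR yR.
  change (W (inl x) (inl y)); apply: cl; rewrite ?inE //; by rewrite eq_sym in xy.
case=> [x|x] [y|y]; rewrite !inE => xP yP // xy.
  have E : x = y by move/card_le1_eqP: h1; apply; rewrite inE.
  by rewrite E eqxx in xy.
by apply: cl; rewrite ?inE.
Qed.

Lemma TER_nim_proper P C g : rim P != setT -> konig cyc (rim P) C g ->
  TER_nim W P = path_nim #|hubs P| #|rim P| #|C|.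
Proof.
have [k] := ubnP #|~: P|; elim: k P C g => // k IH P C g; rewrite ltnS => Pk RT kC.
have half := konig_half kC.
have termE := konig_clique (@cycle_sym n) kC.
have [term|nterm] := boolP (path_terminal #|hubs P| #|rim P| #|C|).
  rewrite /path_nim term; apply: TER_nim_terminal; apply: wheel_clique_hull.
  by apply/wheel_clique; case/andP: term => -> /termE.
have hullT : hull W (~: P) = setT.
  have [/wheel_clique[h1 /termE h2]|//] := wheel_hull (~: P).
  by rewrite /path_terminal h1 h2 in nterm.
(* A move leaves fewer vertices and keeps the rim proper, so the induction hypothesis applies to
   every option. *)
have IHS x C' g' : x \notin P -> konig cyc (rim (x |: P)) C' g' ->
    TER_nim W (x |: P) = path_nim #|hubs (x |: P)| #|rim (x |: P)| #|C'|.
  move=> xP; apply: IH.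
    apply: leq_trans Pk; apply: proper_card; rewrite properC properE subsetUr.
    by apply/subsetPn; exists x; rewrite // setU11.
  apply: contraNneq RT => E; rewrite -subTset -E; apply/subsetP => j.
  by rewrite !inE negb_or => /andP[].
have IHhub i : i \in hubs P ->
    TER_nim W (inl i |: P) = path_nim #|hubs P|.-1 #|rim P| #|C|.
  move=> iP; have iP' := iP; rewrite inE in iP'.
  rewrite (IHS _ C g iP') ?rim_inl // hubs_inl.
  by rewrite (cardsD1 i (hubs P)) iP.
have IHrim j C' g' : j \in rim P -> konig cyc (rim P :\ j) C' g' ->
    TER_nim W (inr j |: P) = path_nim #|hubs P| #|rim P|.-1 #|C'|.
  move=> jP kC'; have jP' := jP; rewrite inE in jP'.
  rewrite (IHS _ C' g' jP') ?rim_inr // hubs_inr.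
  by rewrite (cardsD1 j (rim P)) jP.
apply: TER_nim_eq => //.
  have [av1 av2 av3] := path_nim_avoid half nterm.
  case=> [i|j] iP.
    have iH : i \in hubs P by rewrite inE.
    by rewrite IHhub //; apply: av1; apply/card_gt0P; exists i.
  have jR : j \in rim P by rewrite inE.
  have [|C' [g' k']] := @cycle_konig n (rim P :\ j).
    by apply: contraNneq RT => E; rewrite -subTset -E subD1set.
  rewrite (IHrim _ _ _ jR k'); have := konig_half k'; have := konig_del kC k'.
  have := cardsD1 j (rim P); rewrite jR; move: half av2 av3.
  move: #|rim P :\ j| #|rim P| #|C'| #|C| =>
    r' r c' c half av2 av3 cR /andP[c'c cc'] half'.
  (* If the cover number stays [c], then [2c <= r - 1], which is the condition for a spare move;
     otherwise it drops by exactly one. *)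
  have [E|NE] := eqVneq c' c; first by rewrite E; apply: av3; lia.
  have -> : c' = c.-1 by lia.
  apply: av2; lia.
move=> u /(path_nim_reach half) [[/card_gt0P[i iH] <-]|[/card_gt0P[j jC] <-]|[lt <-]].
- by exists (inl i); [rewrite inE in iH | apply: IHhub].
- have jR : j \in rim P by case: kC => /subsetP/(_ _ jC).
  exists (inr j); first by rewrite inE in jR.
  rewrite (IHrim _ _ _ jR (konig_drop kC jC)).
  by rewrite (cardsD1 j C) jC.
- have [j jR kj] := konig_spare kC lt.
  by exists (inr j); [rewrite inE in jR | apply: IHrim kj].
Qed.

(** The whole rim contains a nonadjacent pair, so such a position is never terminal. Hub moves stay
    in this family, and a rim move leaves a path handled by [TER_nim_proper]. *)
Lemma TER_nim_full P : rim P = setT -> TER_nim W P = cycle_nim #|hubs P| n.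
Proof.
have [k] := ubnP #|hubs P|; elim: k P => // k IH P; rewrite ltnS => Pk RT.
have hullT : hull W (~: P) = setT.
  have [/wheel_clique[_]|//] := wheel_hull (~: P).
  have [i [j /andP[ij nij]]] := cycle_nonadjacent.
  by rewrite RT => /(_ i j (in_setT _) (in_setT _) ij); rewrite (negPf nij).
have IHhub i : i \in hubs P ->
    TER_nim W (inl i |: P) = cycle_nim #|hubs P|.-1 n.
  move=> iP; have cH := cardsD1 i (hubs P); rewrite iP -hubs_inl in cH.
  by rewrite cH in Pk *; rewrite IH ?rim_inl.
have IHrim j : TER_nim W (inr j |: P) = path_nim #|hubs P| n.-1 n.-1./2.
  have rE : rim (inr j |: P) = [set~ j] by rewrite rim_inr RT setTD.
  have RT' : [set~ j] != setT.
    by apply/eqP => /setP /(_ j); rewrite !inE eqxx.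
  have [C [g kC]] := cycle_konig RT'.
  by rewrite (@TER_nim_proper _ C g) rE // hubs_inr cardsC1 card_ord
     (cycle_del_konig kC).
apply: TER_nim_eq => //.
  have [av1 av2] := cycle_nim_avoid #|hubs P| n_gt3.
  case=> [i|j] iP; last by rewrite IHrim.
  have iH : i \in hubs P by rewrite inE.
  by rewrite IHhub //; apply: av1; apply/card_gt0P; exists i.
move=> u /(cycle_nim_reach n_gt3) [[/card_gt0P[i iH] <-]|<-].
  by exists (inl i); [rewrite inE in iH | apply: IHhub].
have [j _] := cycle_nonadjacent.
exists (inr j); last exact: IHrim.
have : j \in rim P by rewrite RT inE.
by rewrite inE.
Qed.

Lemma nim_TER_wheel : nim_TER W = cycle_nim m n.
Proof.
rewrite /nim_TER TER_nim_full; last by apply/setP => j; rewrite !inE.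
congr cycle_nim; rewrite -[RHS]card_ord -cardsT; congr #|pred_of_set _|.
by apply/setP => j; rewrite !inE.
Qed.

End Wheel.

Theorem theorem5p43 (m n : nat) (hm : 2 <= m) (hn : 4 <= n) :
  let d : int := (n%:Z - m%:Z)%R in
  [/\ ~~ odd (n + m) -> (2 <= d)%R -> nim_TER (@wheel m n) = 0,
      odd (n + m) -> (d <= 0)%R -> nim_TER (@wheel m n) = 0,
      ~~ odd (n + m) -> (d <= 0)%R -> nim_TER (@wheel m n) = 1,
      odd (n + m) -> (2 <= d)%R -> nim_TER (@wheel m n) = 1
    & d = 1%R -> nim_TER (@wheel m n) = 2].
Proof.
(* The test [m.+1 == n] is [d = 1], while [m == 1] is excluded by [hm]. *)
rewrite /= nim_TER_wheel // /cycle_nim addnC.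
split; split_ifs; lia.
Qed.
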